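(* If two framed virtual strings are homotopic, then their based matrices are homologous (with respect to the framed elementary extensions $\hat M_1,\hat M_2,\hat M_3,\hat M_w$ and their inverses).
   Context: A virtual string $\alpha$ is an oriented circle (core circle) with $2m$ distinct points partitioned into $m$ ordered pairs, called arrows; an arrow $(a,b)$ has tail $a$ and head $b$. The set of arrows is $\mathrm{arr}(\alpha)$. A virtual string encodes a flat virtual knot diagram (a generic immersed oriented closed plane curve whose double points are flat classical crossings or virtual crossings): the core circle parametrizes the curve, each flat classical crossing gives an arrow joining its two preimages, directed so that (tangent vector at the tail branch, tangent vector at the head branch) is a positively oriented basis of the plane; virtual crossings give no arrows. Framed virtual strings are virtual strings considered up to framed homotopy: two are homotopic if corresponding flat diagrams are related by planar isotopy, virtual and mixed Reidemeister moves, flat Reidemeister moves 2 and 3, and the flat framed Reidemeister move 1, which inserts or removes on an arc two consecutive kinks (flat Reidemeister 1 itself is not allowed). A based matrix is a triple $(G,s,b)$ with $G$ a finite set, $s\in G$ and $b\colon G\times G\to\mathbb{Z}$ skew-symmetric. The based matrix of $\alpha$ has $G=\{s\}\sqcup\mathrm{arr}(\alpha)$ and $b$ as follows. Write $xy$ for the oriented arc of the core circle from $x$ to $y$, $(xy)^\circ$ for its interior. For $e=(a,b)\in\mathrm{arr}(\alpha)$, $b(e,s)$ is the number of arrows with tail in $(ab)^\circ$ and head in $(ba)^\circ$ minus the number with head in $(ab)^\circ$ and tail in $(ba)^\circ$. For arrows $e=(a,b)$, $f=(c,d)$, $b(e,f)=ab\cdot cd+\varepsilon$, where $ab\cdot cd$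 is the number of arrows with tail in $(ab)^\circ$ and head in $(cd)^\circ$ minus the number with head in $(ab)^\circ$ and tail in $(cd)^\circ$, and $\varepsilon=1$ if $c\in(ab)^\circ$, $d\in(ba)^\circ$ ($f$ links $e$ positively), $\varepsilon=-1$ if $c\in(ba)^\circ$, $d\in(ab)^\circ$ ($f$ links $e$ negatively), $\varepsilon=0$ otherwise (unlinked). An element $g\in G\setminus\{s\}$ is annihilating if $b(g,h)=0$ for all $h\in G$, and core if $b(g,h)=b(s,h)$ for all $h\in G$; $g_1,g_2\in G\setminus\{s\}$ are complementary if $b(g_1,h)+b(g_2,h)=b(s,h)$ for all $h\in G$. Framed elementary extensions: $\hat M_1$ (resp. $\hat M_2$) adds two new elements to $G$, extending $b$ so that both are annihilating (resp. both are core); $\hat M_3$ adds two new elements, extending $b$ to any skew-symmetric map in which they are complementary; $\hat M_w$ changes one annihilating element $g$ into a core element, leaving $b$ unchanged on pairs not involving $g$. Two based matrices are isomorphic if there is a bijection of the underlying sets preserving $s$ and $b$, and homologous if they are related, up to isomorphism, by a finite sequence of moves $\hat M_1,\hat M_2,\hat M_3,\hat M_w$ and their inverses. *)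

(* Defs.v *)
From Stdlib Require Import Relation_Operators.
From HB Require Import structures.
From mathcomp Require Import all_boot all_order all_algebra zify.

Set Implicit Arguments.
Unset Strict Implicit.
Unset Printing Implicit Defensive.
Import GRing.Theory.

(** * Virtual strings

    Only the cyclic order of the 2m points on the core circle matters, so the
    circle is cut at a base point and recorded as the list of the points in the
    order in which they are met.  The point [(e, true)] is the tail of the arrow
    [e] and [(e, false)] is its head. *)

Record virtual_string := VirtualString {
  arr : finType;
  pts : seq (arr * bool);
  pts_uniq : uniq pts;
  pts_full : forall p : arr * bool, p \in pts }.

Definition arrow_tail (A : Type) (e : A) : A * bool := (e, true).
Definition arrow_head (A : Type) (e : A) : A * bool := (e, false).
Definition opposite (A : Type) (p : A * bool) : A * bool := (p.1, ~~ p.2).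

(** Interior of the oriented arc [xy] of the circle, for [x != y]
    ([path.arc w x y] contains [x] but not [y]). *)
Definition open_arc (A : eqType) (w : seq A) (x y : A) : seq A :=
  behead (path.arc w x y).

(** * Based matrices *)

Record based_matrix := BasedMatrix {
  bm_set : finType;
  bm_s : bm_set;
  bm_b : bm_set -> bm_set -> int;
  bm_skew : forall g h, bm_b g h = (- bm_b h g)%R }.

Section MatrixOfString.

Variable alpha : virtual_string.
Implicit Types (e f : arr alpha) (I J : seq (arr alpha * bool)).

Definition inner e := open_arc (pts alpha) (arrow_tail e) (arrow_head e).
Definition outer e := open_arc (pts alpha) (arrow_head e) (arrow_tail e).

(** Arrows with tail in [I] and head in [J], minus those with head in [I] and
    tail in [J]. *)
Definition arrow_count I J : int :=
  (#|[set f | (arrow_tail f \in I) && (arrow_head f \in J)]|%:Z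
   - #|[set f | (arrow_head f \in I) && (arrow_tail f \in J)]|%:Z)%R.

Definition linking e f : int :=
  if (arrow_tail f \in inner e) && (arrow_head f \in outer e) then 1%R
  else if (arrow_tail f \in outer e) && (arrow_head f \in inner e) then (- 1)%R
  else 0%R.

(** [None] is the distinguished element [s]. *)
Definition string_b (g h : option (arr alpha)) : int :=
  match g, h with
  | None, None => 0%R
  | Some e, None => arrow_count (inner e) (outer e)
  | None, Some e => (- arrow_count (inner e) (outer e))%R
  | Some e, Some f => (arrow_count (inner e) (inner f) + linking e f)%R
  end.

Lemma arrow_countC I J : arrow_count I J = (- arrow_count J I)%R.
Proof.
rewrite /arrow_count opprB; congr (_%:Z - _%:Z)%R;
  by apply: eq_card => f; rewrite !inE andbC.
Qed.

End MatrixOfString.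

Lemma mem_open_arc (A : eqType) (w : seq A) (x y z : A) :
  uniq w -> x \in w -> y \in w -> z \in w -> x != y ->
  (z \in open_arc w x y) =
    if index x w < index y w then index x w < index z w < index y w
    else (index x w < index z w) || (index z w < index y w).
Proof.
move=> Uw /splitPr xw; case: xw Uw => p q.
rewrite -cat1s uniq_catCA /= mem_cat negb_or => /andP[/andP[xp xq] Upq] yw zw nxy.
have ix : index x (p ++ x :: q) = size p.
  by rewrite index_cat (negbTE xp) /= eqxx addn0.
rewrite /open_arc /path.arc ix rot_size_cat /= (negbTE nxy) /=.
have {yw} : y \in p ++ q.
  by move: yw; rewrite !mem_cat !inE (eq_sym y) (negbTE nxy).
have [<- yw | nxz yw] := eqVneq x z.
  rewrite ix ltnn /= (_ : x \in _ = false); last first.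
    by apply/negP => /mem_take; rewrite mem_cat (negbTE xp) (negbTE xq).
  by case: ltnP => // /ltn_geF; case: ltnP.
have {}zw : z \in p ++ q.
  by move: zw; rewrite !mem_cat !inE (eq_sym z) (negbTE nxz).
have nyz t : t \in p ++ q -> x != t -> (index t (q ++ p) =
    if t \in p then size q + index t p else index t q) /\
  index t (p ++ x :: q) = (if t \in p then index t p else (size p + index t q).+1).
  move=> tpq nxt; rewrite !index_cat /= (negbTE nxt) addnS; split => //.
  move: tpq Upq; rewrite mem_cat cat_uniq => tpq /and3P[_ /hasPn H _].
  by case: (boolP (t \in q)) => [/H /negbTE -> // | tq]; move: tpq;
    rewrite (negbTE tq) orbF => ->.
rewrite in_take; last by rewrite mem_cat orbC -mem_cat.
have [-> ->] := nyz z zw nxz; have [-> ->] := nyz y yw nxy.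
have ip t : t \in p -> index t p < size p by rewrite index_mem.
have iq t : t \in p ++ q -> t \notin p -> index t q < size q.
  by rewrite mem_cat index_mem => /orP[->|].
move: (ip z) (ip y) (iq z zw) (iq y yw).
case: (z \in p); case: (y \in p) => /= hz hy hz' hy'; case: ifP => ?; lia.
Qed.

Lemma linkingC (alpha : virtual_string) (e f : arr alpha) :
  linking e f = (- linking f e)%R.
Proof.
have U := pts_uniq alpha; have F := @pts_full alpha.
have N (p q : arr alpha * bool) :
    p != q -> index p (pts alpha) != index q (pts alpha).
  by apply: contra => /eqP E; rewrite -(nth_index p (F p)) E nth_index.
have TH (g : arr alpha) : arrow_tail g != arrow_head g by rewrite xpair_eqE andbF.
have HT (g : arr alpha) : arrow_head g != arrow_tail g by rewrite xpair_eqE andbF.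
rewrite /linking /inner /outer !mem_open_arc //.
have [<- | nef] := eqVneq e f; first by case: ltngtP; rewrite ?ltnn ?oppr0.
have := N _ _ (TH e); have := N _ _ (TH f).
have D (b b' : bool) : (e, b) != (f, b') by rewrite xpair_eqE (negbTE nef).
have := N _ _ (D true true); have := N _ _ (D true false).
have := N _ _ (D false true); have := N _ _ (D false false).
rewrite /arrow_tail /arrow_head.
move: (index (e, true) _) (index (e, false) _) (index (f, true) _) (index (f, false) _).
move=> a b c d; clear.
case: (ltngtP c d) => //; case: (ltngtP a b) => //; case: (ltngtP b d) => //;
case: (ltngtP b c) => //; case: (ltngtP a d) => //; case: (ltngtP a c) => //=;
  by rewrite ?oppr0 ?opprK //; lia.
Qed.

Lemma string_bN (alpha : virtual_string) (g h : option (arr alpha)) :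
  string_b g h = (- string_b h g)%R.
Proof.
case: g h => [e|] [f|] /=; rewrite ?opprK ?oppr0 //.
by rewrite opprD -linkingC -arrow_countC.
Qed.

Definition string_matrix (alpha : virtual_string) : based_matrix :=
  BasedMatrix None (@string_bN alpha).

(** * Homology of based matrices *)

Section Elements.

Variable M : based_matrix.
Implicit Types g : bm_set M.

Definition annihilating g : Prop :=
  g != bm_s M /\ forall h, bm_b g h = 0%R.

Definition core g : Prop :=
  g != bm_s M /\ forall h, bm_b g h = bm_b (bm_s M) h.

Definition complementary g1 g2 : Prop :=
  [/\ g1 != bm_s M, g2 != bm_s M
    & forall h, (bm_b g1 h + bm_b g2 h = bm_b (bm_s M) h)%R].

End Elements.

Definition bm_isomorphic (M N : based_matrix) : Prop :=
  exists2 phi : bm_set M -> bm_set N, bijective phi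
    & phi (bm_s M) = bm_s N /\ forall g h, bm_b (phi g) (phi h) = bm_b g h.

Definition two_extension (M N : based_matrix) (phi : bm_set M -> bm_set N)
    (g1 g2 : bm_set N) : Prop :=
  [/\ injective phi, phi (bm_s M) = bm_s N,
      forall g h, bm_b (phi g) (phi h) = bm_b g h,
      g1 != g2
    & forall g, (g \in codom phi) = (g \notin [:: g1; g2])].

Inductive framed_extension (M N : based_matrix) : Prop :=
| ext_M1 phi g1 g2 of @two_extension M N phi g1 g2
    & annihilating g1 & annihilating g2
| ext_M2 phi g1 g2 of @two_extension M N phi g1 g2
    & core g1 & core g2
| ext_M3 phi g1 g2 of @two_extension M N phi g1 g2
    & complementary g1 g2
| ext_Mw (phi : bm_set M -> bm_set N) (g : bm_set M) of
    bijective phi & phi (bm_s M) = bm_s N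
    & (forall h k, h != g -> k != g -> bm_b (phi h) (phi k) = bm_b h k)
    & annihilating g & core (phi g).

Definition homologous : based_matrix -> based_matrix -> Prop :=
  clos_refl_sym_trans based_matrix
    (fun M N => bm_isomorphic M N \/ framed_extension M N).

(** * Flat virtual knot diagrams

    A generic closed plane curve is recorded, up to planar isotopy, by the
    virtual string of all its double points, flat and virtual alike, each arrow
    directed so that (tangent at the tail, tangent at the head) is a positive
    basis.  These directions give the cyclic order of the four half-edges at
    each double point, hence a combinatorial map.

    A dart [(p, d)] is the edge of the curve starting at the point [p],
    travelled along the orientation if [d] and against it otherwise.
    [face_next] follows the boundary of the region on the left of the dart:
    arriving at a double point, it turns left onto the other branch, which
    leaves along the orientation exactly when one arrives forwards on the tail
    branch or backwards on the head branch. *)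

Section Planarity.

Variable alpha : virtual_string.

Definition dart : finType := ((arr alpha * bool) * bool)%type.

Definition face_next (x : dart) : dart :=
  let p := if x.2 then next (pts alpha) x.1 else x.1 in
  let d := x.2 == p.2 in
  (if d then opposite p else prev (pts alpha) (opposite p), d).

(** Euler's formula V - E + F = 2 for the connected 4-valent map with n
    vertices and 2n edges; the curve without double points has no darts and is
    planar. *)
Definition planar : bool :=
  (#|arr alpha| == 0) || (fcard face_next predT == #|arr alpha|.+2).

End Planarity.

(** The unbounded region is not recorded: pushing an arc across infinity is a
    composition of virtual and mixed moves, so plane diagrams and diagrams on
    the sphere have the same equivalence classes. *)
Record flat_diagram := FlatDiagram {
  curve :> virtual_string;
  virt : pred (arr curve);
  curve_planar : planar curve }.

Definition relabel (A B : Type) (f : A -> B) (p : A * bool) : B * bool :=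
  (f p.1, p.2).

(** [alpha] is the virtual string of the flat crossings of [D]. *)
Definition encodes (alpha : virtual_string) (D : flat_diagram) : Prop :=
  exists (f : arr alpha -> arr D) (k : nat),
    map (relabel f) (pts alpha) = rot k [seq p <- pts D | ~~ virt p.1].

Definition kink (A : Type) (p : A * bool) : seq (A * bool) :=
  [:: p; opposite p].

(** Three oriented strands 1, 2, 3 crossing pairwise in a disc.  The crossing
    [x_i] is that of the two strands other than [i], and [d_i] tells whether its
    tail lies on the strand [i + 1] (indices mod 3).  Of the eight orders of
    passage along the strands, straight lines with these signs realize exactly
    two: either every strand first meets the strand carrying the tail of the
    crossing of the other two ([c = true]), or every strand first meets the one
    carrying its head ([c = false]).  The third move exchanges these two.
    [r3_strand c d_i p q] is the strand [i], with [p] its crossing with [i + 1]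
    and [q] its crossing with [i + 2]. *)
Definition r3_strand (A : Type) (c d : bool) (p q : A * bool) :
    seq (A * bool) :=
  if d == c then [:: p; q] else [:: q; p].

Definition r3_word (A : Type) (c : bool) (x1 x2 x3 : A) (d1 d2 d3 : bool)
    (u v w : seq (A * bool)) : seq (A * bool) :=
  r3_strand c d1 (x3, d3) (x2, ~~ d2) ++ u ++
  r3_strand c d2 (x1, d1) (x3, ~~ d3) ++ v ++
  r3_strand c d3 (x2, d2) (x1, ~~ d1) ++ w.

(** In each constructor [f] sends the crossings of [D] to those of [E], keeping
    their type.  The base points are placed conveniently; [fm_isotopy] moves
    them.  In [fm_R2] the two new crossings are both flat or both virtual.  In
    [fm_R3] they are all flat, all virtual, or exactly two are virtual (the mixed
    move); one virtual and two flat crossings is the forbidden move. *)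
Inductive framed_move (D E : flat_diagram) : Prop :=
| fm_isotopy (f : arr D -> arr E) k of
    (forall e, virt (f e) = virt e)
    & pts E = rot k (map (relabel f) (pts D))
| fm_virtual_R1 (f : arr D -> arr E) (p : arr E * bool) of
    (forall e, virt (f e) = virt e)
    & virt p.1
    & pts E = kink p ++ map (relabel f) (pts D)
| fm_framed_R1 (f : arr D -> arr E) (p q : arr E * bool) of
    (forall e, virt (f e) = virt e)
    & ~~ virt p.1 & ~~ virt q.1
    & pts E = kink p ++ kink q ++ map (relabel f) (pts D)
| fm_R2 (f : arr D -> arr E) (x y : arr E) (t same : bool) u v of
    (forall e, virt (f e) = virt e)
    & virt x = virt y
    & map (relabel f) (pts D) = u ++ v
    & pts E = [:: (x, t); (y, ~~ t)] ++ u ++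
        (if same then [:: (x, ~~ t); (y, t)] else [:: (y, t); (x, ~~ t)]) ++ v
| fm_R3 (f : arr D -> arr E) c (x1 x2 x3 : arr E) (d1 d2 d3 : bool) u v w of
    (forall e, virt (f e) = virt e)
    & virt x1 + virt x2 + virt x3 != 1
    & map (relabel f) (pts D) = r3_word c x1 x2 x3 d1 d2 d3 u v w
    & pts E = r3_word (~~ c) x1 x2 x3 d1 d2 d3 u v w.

Definition framed_homotopic (alpha beta : virtual_string) : Prop :=
  exists D E : flat_diagram,
    [/\ encodes alpha D, encodes beta E
      & clos_refl_sym_trans flat_diagram framed_move D E].

(* Main.v *)
(** Give each point of the core circle the weight 0, 1 or 2 with respect to an
    arrow [e], according as it lies outside the arc from the tail to the head of
    [e], is an endpoint of [e], or lies inside the arc; with respect to [s] every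
    point has weight 2.  Then [4 b(g, h)] is the sum, over all arrows, of the
    2x2 minors formed by the weights of the tail and of the head with respect to
    [g] and [h]: the half weights of the endpoints produce exactly the linking
    term.  The weights are a cyclic expression in the order of the points, so
    each move is reduced to the few points it touches.  A kink is annihilating
    or core, hence two kinks give an extension of the first or second kind, or
    of the third kind when they are of opposite types; the arrows of a bigon are
    complementary; and the third move leaves the matrix unchanged. *)

From Stdlib Require Import Relation_Operators.
Require Import Defs.
From mathcomp Require Import all_boot all_order all_algebra zify ring.

Set Implicit Arguments.
Unset Strict Implicit.
Unset Printing Implicit Defensive.
Import GRing.Theory.

Local Open Scope ring_scope.

(** * Weights *)

Section Position.

Variable T : eqType.
Implicit Types (w s S : seq T) (x y z : T).

(** A sign, 0 when the two positions agree; a letter absent from [w] counts as lying after all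
    letters of [w]. *)
Definition before w x y : int :=
  (index x w < index y w)%N%:Z - (index y w < index x w)%N%:Z.

Lemma beforeC w x y : before w x y = - before w y x.
Proof. by rewrite /before opprB. Qed.

Lemma before_cat s1 s2 x y :
  before (s1 ++ s2) x y =
    if x \in s1 then if y \in s1 then before s1 x y else 1
    else if y \in s1 then -1 else before s2 x y.
Proof.
rewrite /before !index_cat.
case: (boolP (x \in s1)); case: (boolP (y \in s1)) => //; rewrite -?index_mem; lia.
Qed.

Lemma before_cons z s x y :
  before (z :: s) x y =
    if z == x then if z == y then 0 else 1
    else if z == y then -1 else before s x y.
Proof. by rewrite /before /=; case: eqP; case: eqP. Qed.

(** A subsequence of a duplicate-free word is a filter of it, and deleting other letters keeps
    relative order. This confines each move to the letters it touches. *)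
Lemma before_subseq s w x y : subseq s w -> uniq w -> x \in s -> y \in s ->
  before s x y = before w x y.
Proof.
move=> sw U xs ys; rewrite ((subseq_uniqP U) sw); elim: w {sw U} => //= z w IH.
have ne t : t \in s -> z \notin s -> (z == t) = false.
  by move=> ts; apply: contraNF => /eqP ->.
by case: ifPn => zs; rewrite !before_cons IH // !ne.
Qed.

(** The block is contiguous, so a letter outside lies before all of it or after all of it. *)
Lemma before_block s1 S s2 x y z : uniq (s1 ++ S ++ s2) ->
  x \notin S -> y \in S -> z \in S ->
  before (s1 ++ S ++ s2) x y = before (s1 ++ S ++ s2) x z.
Proof.
rewrite cat_uniq has_cat negb_or => /and3P[_ /andP[/hasPn n _] _] xS yS zS.
by rewrite !before_cat (negbTE xS) yS zS (negbTE (n y yS)) (negbTE (n z zS)).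
Qed.

(** On three distinct points of [w] this is 1 if they occur in this cyclic order and -1 otherwise;
    it vanishes when two of them coincide. *)
Definition cyclic w x y z : int := before w x y + before w y z + before w z x.

(** Rotation reverses exactly the pairs with one point in each piece. Around a cycle of three points
    there are none or two such pairs, with opposite signs, so the changes cancel. *)
Lemma cyclic_rot k w x y z : uniq w -> x \in w -> y \in w -> z \in w ->
  cyclic (rot k w) x y z = cyclic w x y z.
Proof.
rewrite -{1 2 3 4 6}(cat_take_drop k w) /rot.
move: (take k w) (drop k w) => s1 s2.
rewrite cat_uniq => /and3P[_ /hasPn n _].
have {n}E t : t \in s1 ++ s2 -> (t \in s2) = (t \notin s1).
  rewrite mem_cat; case: (boolP (t \in s2)) => [/n /negbTE /= ->|_] //.
  by rewrite orbF => ->.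
move=> /E xE /E yE /E zE; rewrite /cyclic !before_cat xE yE zE.
by case: (x \in s1); case: (y \in s1); case: (z \in s1) => /=; lia.
Qed.

End Position.

Lemma before_map (T T' : eqType) (f : T -> T') w x y : injective f ->
  before (map f w) (f x) (f y) = before w x y.
Proof. by move=> fI; rewrite /before !index_map. Qed.

(** * The skew form defined by weights *)

Section Form.

Variable A : finType.
Implicit Types (w : seq (A * bool)) (g h : option A) (p : A * bool).

Definition weight w g p : int :=
  if g is Some e then cyclic w (arrow_tail e) p (arrow_head e) + 1 else 2.

Definition minor w g h (x : A) : int :=
  weight w g (arrow_tail x) * weight w h (arrow_head x)
  - weight w g (arrow_head x) * weight w h (arrow_tail x).

Definition weight_form w g h : int := \sum_x minor w g h x.

Lemma weight_self w e b : weight w (Some e) (e, b) = 1.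
Proof.
rewrite /weight /cyclic; case: b; rewrite (beforeC _ (arrow_head e));
  rewrite /arrow_tail /arrow_head /before ltnn; lia.
Qed.

End Form.

(** * Comparison of the weight form with the based matrix *)

Section StringForm.

Variable alpha : virtual_string.
Implicit Types (e f : arr alpha) (p : arr alpha * bool).

Local Notation w := (pts alpha).

Lemma index_pts_inj : injective (index^~ w).
Proof.
by move=> p q E; rewrite -(nth_index p (pts_full p)) E nth_index ?pts_full.
Qed.

Lemma mem_inner_self e b : ((e, b) \in inner e = false) * ((e, b) \in outer e = false).
Proof.
rewrite /inner /outer !mem_open_arc ?pts_uniq ?pts_full // ?xpair_eqE ?andbF //.
by case: b; rewrite /arrow_tail /arrow_head !ltnn ?andbF; case: ltngtP.
Qed.

Lemma weight_inner e p : p.1 != e ->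
  weight w (Some e) p = 2 * (p \in inner e)%:Z /\ (p \in outer e) = (p \notin inner e).
Proof.
case: p => x b /= n.
rewrite /inner /outer !mem_open_arc ?pts_uniq ?pts_full // ?xpair_eqE ?andbF //.
have N (b' : bool) : index (x, b) w != index (e, b') w.
  by apply: contra n => /eqP/index_pts_inj[->].
move: (N true) (N false); have : index (e, true) w != index (e, false) w.
  by apply/eqP => /index_pts_inj.
(* Everything depends only on the relative order of three distinct positions. *)
rewrite /weight /cyclic /before /arrow_tail /arrow_head.
move: (index (x, b) _) (index (e, true) _) (index (e, false) _) => i j k.
by case: (ltngtP i j) => //; case: (ltngtP i k) => //; case: (ltngtP j k) => //=; lia.
Qed.

Lemma arrow_countE (I J : seq (arr alpha * bool)) :
  arrow_count I J = \sum_(x : arr alpha)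
    ((arrow_tail x \in I)%:Z * (arrow_head x \in J)%:Z
     - (arrow_head x \in I)%:Z * (arrow_tail x \in J)%:Z).
Proof.
rewrite /arrow_count sumrB -!sum1_card !(big_morph _ PoszD (erefl 0%:Z)).
congr (_ - _); rewrite big_mkcond; apply: eq_bigr => x _; rewrite inE;
  by do 2! case: (_ \in _).
Qed.

(** Away from the endpoints of [e] and [f] weights are twice the indicators of the inner arcs, so
    each minor is four times its term in the arrow count. The arrows [e] and [f] have no such term;
    their own minors give the linking number. *)
Lemma string_bE (g h : option (arr alpha)) : 4 * string_b g h = weight_form w g h.
Proof.
(* Arrows leaving an arc minus arrows entering it amount to tails inside minus heads inside, which
   is the pairing with the constant weight of [s]. *)
have sN e : 4 * arrow_count (inner e) (outer e) = weight_form w (Some e) None.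
  rewrite arrow_countE mulr_sumr; apply: eq_bigr => x _; rewrite /minor.
  have [->|n] := eqVneq x e; first by rewrite !weight_self !mem_inner_self.
  have [-> ->] := @weight_inner e (arrow_tail x) n.
  have [-> ->] := @weight_inner e (arrow_head x) n.
  by rewrite /weight; do 2! case: (_ \in _).
have formC g' h' : weight_form w g' h' = - weight_form w h' g'.
  by rewrite /weight_form -sumrN; apply: eq_bigr => x _; rewrite /minor; lia.
case: g h => [e|] [f|] //=; first last.
- by rewrite /weight_form big1 // => x _; rewrite /minor subrr.
- by rewrite mulrN sN -formC.
rewrite arrow_countE mulrDr mulr_sumr.
pose F (x : arr alpha) : int :=
  (arrow_tail x \in inner e)%:Z * (arrow_head x \in inner f)%:Z
  - (arrow_head x \in inner e)%:Z * (arrow_tail x \in inner f)%:Z.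
suff E : \sum_x (minor w (Some e) (Some f) x - 4 * F x) = 4 * linking e f.
  by rewrite -E /weight_form sumrB addrC subrK.
have Z x : x != e -> x != f -> minor w (Some e) (Some f) x - 4 * F x = 0.
  move=> ne nf; rewrite /minor /F.
  rewrite !(@weight_inner e _ _).1 // !(@weight_inner f _ _).1 //.
  by do 4! case: (_ \in _).
have [fe|nef] := eqVneq e f.
  subst f; rewrite (bigD1 e) //= big1 => [|x ne]; last by apply: Z.
  by rewrite /minor /F !weight_self /linking !mem_inner_self.
rewrite (bigD1 e) //= (bigD1 f) 1?eq_sym //= big1 => [|x /andP[]]; last exact: Z.
rewrite /minor /F !weight_self !mem_inner_self /=.
have N (p q : arr alpha * bool) : p != q -> index p w != index q w.
  by apply: contra => /eqP/index_pts_inj ->.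
have D (b b' : bool) : (e, b) != (f, b') by rewrite xpair_eqE (negbTE nef).
have := N _ _ (D true true); have := N _ _ (D true false).
have := N _ _ (D false true); have := N _ _ (D false false).
have D' (x : arr alpha) : (x, true) != (x, false) by rewrite xpair_eqE andbF.
have := N _ _ (D' e); have := N _ _ (D' f).
rewrite /linking /inner /outer !mem_open_arc ?pts_uniq ?pts_full // ?xpair_eqE ?andbF //.
rewrite /weight /cyclic /before /arrow_tail /arrow_head.
(* Only the minors of [e] and [f] are left, and they depend on the order of four positions. *)
move: (index (e, true) _) (index (e, false) _) (index (f, true) _) (index (f, false) _).
move=> a b c d; clear.
case: (ltngtP c d) => //; case: (ltngtP a b) => //; case: (ltngtP b d) => //;
case: (ltngtP b c) => //; case: (ltngtP a d) => //; case: (ltngtP a c) => //=; lia.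
Qed.

End StringForm.

Lemma relabel_inj (A B : Type) (f : A -> B) : injective f -> injective (relabel f).
Proof. by move=> fI [a b] [a' b'] [/fI -> ->]. Qed.

Lemma weight_map (A B : finType) (f : A -> B) w g p : injective f ->
  weight (map (relabel f) w) (omap f g) (relabel f p) = weight w g p.
Proof.
move=> fI; case: g => //= e; rewrite /cyclic.
rewrite (_ : arrow_tail (f e) = relabel f (arrow_tail e)) //.
rewrite (_ : arrow_head (f e) = relabel f (arrow_head e)) //.
by rewrite !before_map //; apply: relabel_inj.
Qed.

(** * Kinks, bigons and triangles in words *)

Section Kink.

Variables (A : finType) (p : A * bool) (s1 s2 : seq (A * bool)).

Let w := s1 ++ kink p ++ s2.

Hypothesis w_uniq : uniq w.

Lemma mem_kink (z : A * bool) : (z \in kink p) = (z.1 == p.1).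
Proof.
case: p z => e b [x c]; rewrite !inE !xpair_eqE /=.
by case: (x == e); case: b; case: c.
Qed.

(** If the tail comes first, the arc from tail to head is empty and all other points lie outside it;
    if the head comes first, that arc runs round the whole rest of the circle. *)
Lemma weight_kink z : z.1 != p.1 -> weight w (Some p.1) z = if p.2 then 0 else 2.
Proof.
move=> n; rewrite /weight /cyclic (beforeC _ (arrow_tail _) z).
have -> : before w z (arrow_tail p.1) = before w z (arrow_head p.1).
  by rewrite /w; apply: before_block; rewrite ?mem_kink.
have: before w p (opposite p) = 1.
  have /hasPn n1 : ~~ has (mem s1) (kink p ++ s2).
    by move: w_uniq; rewrite /w cat_uniq => /and3P[].
  have np : p \notin s1 by apply: n1; rewrite inE eqxx.
  have no : opposite p \notin s1 by apply: n1; rewrite !inE eqxx orbT.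
  rewrite before_cat (negbTE np) (negbTE no) before_cons eqxx.
  by case: (p) => e b; rewrite xpair_eqE; case: b; rewrite andbF.
rewrite (surjective_pairing p) /opposite /=; case: p.2 => /= E.
  by rewrite (beforeC _ (arrow_head _) (arrow_tail _)) E; lia.
by rewrite E; lia.
Qed.

(** No endpoint of another arrow lies between the two adjacent points of the kink. *)
Lemma weight_in_kink h : h != Some p.1 -> weight w h p = weight w h (opposite p).
Proof.
case: h => [e|] //= n; rewrite /cyclic.
have E x : x.1 != p.1 -> before w x p = before w x (opposite p).
  by move=> nx; apply: before_block; rewrite ?mem_kink.
by rewrite !(beforeC _ _ (arrow_head e)) !E //; apply: contra n => /eqP <-.
Qed.

Lemma minor_kink g h : g != Some p.1 -> h != Some p.1 -> minor w g h p.1 = 0.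
Proof.
move=> /weight_in_kink Eg /weight_in_kink Eh; move: Eg Eh.
rewrite (surjective_pairing p) /opposite /minor /arrow_tail /arrow_head /=.
by case: p.2 => /= -> ->; rewrite subrr.
Qed.

(** Off its own endpoints the kink has the constant weight 0 or 2. At its endpoints both rows
    involved are constant, or the two rows agree, so that minor vanishes. *)
Lemma weight_form_kink h : weight_form w (Some p.1) h = if p.2 then 0 else weight_form w None h.
Proof.
transitivity (\sum_x if p.2 then 0 else minor w None h x); last first.
  by case: p.2 => //; rewrite big1.
apply: eq_bigr => x _; have [-> | nx] := eqVneq x p.1; last first.
  by rewrite /minor !weight_kink //=; case: p.2; lia.
have [-> | nh] := eqVneq h (Some p.1).
  by rewrite /minor !weight_self /weight; case: p.2; lia.
rewrite (@minor_kink None) // /minor !weight_self.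
have := weight_in_kink nh; rewrite (surjective_pairing p) /opposite /=.
by rewrite /arrow_tail /arrow_head; case: p.2 => //= ->; lia.
Qed.

End Kink.

(** * Bigons *)

Section Bigon.

Variables (A : finType) (x y : A) (t same : bool) (u v : seq (A * bool)).

Let a := (x, t).
Let b := (y, ~~ t).
Let a' := (x, ~~ t).
Let b' := (y, t).
Let S := if same then [:: a'; b'] else [:: b'; a'].
(** The bigon alone on the circle: orders among its four letters can be computed here. *)
Let w0 := [:: a; b] ++ S.
Let w := [:: a; b] ++ u ++ S ++ v.

Hypothesis w_uniq : uniq w.

(** If [x = y], then [a] and [b'] are one letter occurring twice. *)
Lemma bigon_neq : x != y.
Proof.
move: w_uniq; rewrite /w /= !inE !mem_cat !negb_or => /andP[/and3P[n _ /andP[n' _]] _].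
apply: contraNneq n'; rewrite /a /S /a' /b' => ->.
by case: same; rewrite !inE eqxx ?orbT.
Qed.

Lemma mem_bigon_second z : (z \in S) = (z \in [:: a'; b']).
Proof. by rewrite /S; case: same => //; rewrite !inE orbC. Qed.

Lemma mem_bigon z : (z.1 \in [:: x; y]) = (z \in [:: a; b]) || (z \in S).
Proof.
rewrite mem_bigon_second; case: z => z c; rewrite /a /b /a' /b' !inE !xpair_eqE /=.
by case: (z == x); case: (z == y); case: t; case: c.
Qed.

Lemma before_bigon z z' : z.1 \in [:: x; y] -> z'.1 \in [:: x; y] ->
  before w z z' = before w0 z z'.
Proof.
rewrite !mem_bigon -!mem_cat => zi zi'; apply/esym/before_subseq => //.
apply: (cat_subseq (subseq_refl [:: a; b])).
by apply: (subseq_trans _ (suffix_subseq _ _)); apply: prefix_subseq.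
Qed.

Lemma before_bigon_block z : z.1 \notin [:: x; y] ->
  before w z a = before w z b /\ before w z a' = before w z b'.
Proof.
rewrite mem_bigon negb_or => /andP[z1 z2]; split.
  by apply: (@before_block _ [::] [:: a; b] (u ++ S ++ v)) => //; rewrite !inE eqxx ?orbT.
by apply: (@before_block _ ([:: a; b] ++ u) S v) => //; rewrite mem_bigon_second !inE eqxx ?orbT.
Qed.

Lemma weight_bigon h : h != Some x -> h != Some y ->
  weight w h a = weight w h b /\ weight w h a' = weight w h b'.
Proof.
case: h => [e|] //= nx ny; rewrite /cyclic.
have E (c : bool) : (e, c).1 \notin [:: x; y] by rewrite !inE negb_or; apply/andP.
rewrite !(beforeC _ _ (arrow_head e)).
by have [-> ->] := before_bigon_block (E true); have [-> ->] := before_bigon_block (E false).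
Qed.

(** For rows of other arrows and of [s], [x] and [y] join the same two places of the circle in
    opposite directions, so their minors cancel. *)
Lemma minor_bigon g h : g != Some x -> g != Some y -> h != Some x -> h != Some y ->
  minor w g h x + minor w g h y = 0.
Proof.
move=> gx gy hx hy; have [Eg Eg'] := weight_bigon gx gy; have [] := weight_bigon hx hy.
move: Eg Eg'; rewrite /minor /arrow_tail /arrow_head /a /b /a' /b'.
by case: t => /= -> -> -> ->; ring.
Qed.

(** The arcs of [x] and [y] run between the two strands in opposite directions, so they cover the
    rest of the circle once and their weights add up to that of [s]. The minors at [x] and [y]
    themselves are compared separately. *)
Lemma weight_form_bigon h :
  weight_form w (Some x) h + weight_form w (Some y) h = weight_form w None h.
Proof.
have nxy := negbTE bigon_neq; have nyx : (y == x) = false by rewrite eq_sym.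
have xx : x \in [:: x; y] by rewrite !inE eqxx.
have yy : y \in [:: x; y] by rewrite !inE eqxx orbT.
have sum2 z : z.1 \notin [:: x; y] -> weight w (Some x) z + weight w (Some y) z = 2.
  move=> nz; have [] := before_bigon_block nz.
  rewrite /weight /cyclic !(beforeC w _ z).
  rewrite (before_bigon (z := arrow_head x)) // (before_bigon (z := arrow_head y)) //.
  rewrite /a /b /a' /b' /arrow_tail /arrow_head => E E'.
  (* Exactly one of the two arrows has its tail on the first strand, so their orders of head and
     tail are opposite. *)
  suff: before w0 (x, false) (x, true) +
        before w0 (y, false) (y, true) = 0.
    by move: E E'; case: t => /=; lia.
  rewrite /before /w0 /S /a /b /a' /b'.
  by case: t; case: same; rewrite /= !xpair_eqE ?eqxx ?nxy ?nyx.
have core (e f : A) c : e \in [:: x; y] -> f \in [:: x; y] ->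
    weight w (Some e) (f, c) = weight w0 (Some e) (f, c).
  by move=> ei fi; rewrite /weight /cyclic !before_bigon.
rewrite /weight_form -big_split /= (bigD1 x) //= [RHS](bigD1 x) //=.
rewrite (bigD1 y) 1?eq_sym ?bigon_neq //= [X in _ = _ + X](bigD1 y) 1?eq_sym ?bigon_neq //=.
rewrite !addrA; congr (_ + _); last first.
  apply: eq_bigr => z /andP[zx zy]; have nz : z \notin [:: x; y] by rewrite !inE negb_or zx.
  have := sum2 (z, true) nz; have := sum2 (z, false) nz; rewrite /minor /arrow_tail /arrow_head.
  move: (weight w (Some x)) (weight w (Some y)) => X Y EF ET.
  have -> : X (z, false) = 2 - Y (z, false) by rewrite -EF addrK.
  have -> : X (z, true) = 2 - Y (z, true) by rewrite -ET addrK.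
  by rewrite /=; ring.
(* A row other than those of [x] and [y] has a single value on each strand; the rows of [x] and [y]
   are read off [w0]. Either way a finite check remains. *)
have wab : weight w h a = weight w h b /\ weight w h a' = weight w h b' \/
    h = Some x \/ h = Some y.
  have [->|hx] := eqVneq h (Some x); first by right; left.
  have [->|hy] := eqVneq h (Some y); first by right; right.
  by left; apply: weight_bigon.
rewrite /minor /arrow_tail /arrow_head !weight_self.
have := core x y true xx yy; have := core x y false xx yy.
have := core y x true yy xx; have := core y x false yy xx.
have := weight_self w x; have := weight_self w y; have wN p : weight w None p = 2 by [].
move: wN wab; rewrite /w0 /S /a /b /a' /b'; move: (weight w) => W WN wab Wy Wx.
rewrite !WN; case: wab => [[]|[->|->]]; rewrite ?Wx ?Wy; case: t; case: same;
  rewrite /weight /cyclic /before /arrow_tail /arrow_head /= !xpair_eqE ?eqxx ?nxy ?nyx /=;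
  do 4? move=> ->; lia.
Qed.

End Bigon.

(** * Triangles of the third move *)

Lemma r3_strand_perm (A : eqType) (c c' d : bool) (p q : A * bool) :
  perm_eq (r3_strand c d p q) (r3_strand c' d p q).
Proof.
rewrite /r3_strand; case: ifP; case: ifP => // _ _.
  exact: (permEl (perm_catC [:: p] [:: q])).
exact: (permEl (perm_catC [:: q] [:: p])).
Qed.

Lemma r3_word_perm (A : eqType) c c' (x1 x2 x3 : A) d1 d2 d3 u v w :
  perm_eq (r3_word c x1 x2 x3 d1 d2 d3 u v w) (r3_word c' x1 x2 x3 d1 d2 d3 u v w).
Proof.
by do 3! (apply: perm_cat; [exact: r3_strand_perm | rewrite ?perm_cat2l]).
Qed.

Lemma mem_r3_strand (A : eqType) c d (p q z : A * bool) :
  (z \in r3_strand c d p q) = (z == p) || (z == q).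
Proof. by rewrite /r3_strand; case: ifP; rewrite !inE // orbC. Qed.

Section Triangle.

Variables (A : finType) (x1 x2 x3 : A) (d1 d2 d3 : bool) (u v w : seq (A * bool)).

Let W c := r3_word c x1 x2 x3 d1 d2 d3 u v w.
Let W0 c := r3_word c x1 x2 x3 d1 d2 d3 [::] [::] [::].
Let S1 c := r3_strand c d1 (x3, d3) (x2, ~~ d2).
Let S2 c := r3_strand c d2 (x1, d1) (x3, ~~ d3).
Let S3 c := r3_strand c d3 (x2, d2) (x1, ~~ d1).
Let xs := [:: x1; x2; x3].

Hypothesis W_uniq : uniq (W true).

Let W_uniq' c : uniq (W c).
Proof. by rewrite (perm_uniq (r3_word_perm c true _ _ _ _ _ _ _ _ _)). Qed.

Lemma mem_strands c z : (z.1 \in xs) = [|| z \in S1 c, z \in S2 c | z \in S3 c].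
Proof.
rewrite !mem_r3_strand; case: z => z b; rewrite !inE !xpair_eqE /=.
by case: (z == x1); case: (z == x2); case: (z == x3);
  case: b; case: d1; case: d2; case: d3.
Qed.

Let sub_W c : subseq (W0 c) (W c).
Proof.
rewrite /W0 /W /r3_word /=.
do 2! (apply: cat_subseq; [by []|]; apply: (subseq_trans _ (suffix_subseq _ _))).
by apply: cat_subseq => //; apply: sub0seq.
Qed.

(** If two crossings coincided, their four letters would take only two values. *)
Lemma triangle_uniq : uniq xs.
Proof.
have: uniq (W0 true) by apply: subseq_uniq (sub_W true) W_uniq.
apply: contraTT; rewrite /xs /= !inE !negb_and !negb_or !negb_and !negbK orbF -orbA.
rewrite /W0 /r3_word /r3_strand; case/or3P => /eqP ->;
  by case: d1; case: d2; case: d3; rewrite /= !inE !xpair_eqE !eqxx ?orbT ?andbF.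
Qed.

(** The move exchanges letters only within a strand, and a letter outside the triangle compares
    alike with both letters of a strand. *)
Lemma before_triangle_swap z z' : z.1 \notin xs ->
  before (W true) z z' = before (W false) z z'.
Proof.
move=> nz; have := nz; rewrite (mem_strands true) !negb_or => /and3P[z1 z2 z3].
move: nz; rewrite (mem_strands false) !negb_or => /and3P[z1' z2' z3'].
rewrite /W /r3_word -/(S1 _) -/(S2 _) -/(S3 _) -/(S1 _) -/(S2 _) -/(S3 _).
rewrite !before_cat (negbTE z1) (negbTE z2) (negbTE z3) (negbTE z1') (negbTE z2') (negbTE z3').
by rewrite !mem_r3_strand.
Qed.

Lemma before_triangle_outer c z : z.1 \notin xs ->
  [/\ before (W c) z (x3, d3) = before (W c) z (x2, ~~ d2),
      before (W c) z (x1, d1) = before (W c) z (x3, ~~ d3)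
    & before (W c) z (x2, d2) = before (W c) z (x1, ~~ d1)].
Proof.
rewrite (mem_strands c) !negb_or => /and3P[z1 z2 z3]; have U := W_uniq' c.
split.
- by apply: (@before_block _ [::] (S1 c)) => //; rewrite mem_r3_strand eqxx ?orbT.
- move: U; rewrite /W /r3_word catA => U.
  by apply: (@before_block _ _ (S2 c)) => //; rewrite mem_r3_strand eqxx ?orbT.
move: U; rewrite /W /r3_word !catA -[(_ ++ S3 _) ++ w]catA => U.
by apply: (@before_block _ _ (S3 c)) => //; rewrite mem_r3_strand eqxx ?orbT.
Qed.

Lemma before_triangle_inner c z z' : z.1 \in xs -> z'.1 \in xs ->
  before (W c) z z' = before (W0 c) z z'.
Proof.
rewrite !(mem_strands c) => zi zi'; apply/esym/(before_subseq (sub_W c)) => //.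
all: by rewrite /W0 /r3_word !mem_cat orbF.
Qed.

Lemma weight_triangle_swap h z : (forall i, i \in xs -> h != Some i) ->
  weight (W true) h z = weight (W false) h z.
Proof.
case: h => //= e /(_ e) n; have E : e \notin xs by apply/negP => /n; rewrite eqxx.
rewrite /cyclic !(beforeC _ z) !(before_triangle_swap (z := (e, _))) //.
Qed.

Lemma weight_triangle_outer c h : (forall i, i \in xs -> h != Some i) ->
  [/\ weight (W c) h (x3, d3) = weight (W c) h (x2, ~~ d2),
      weight (W c) h (x1, d1) = weight (W c) h (x3, ~~ d3)
    & weight (W c) h (x2, d2) = weight (W c) h (x1, ~~ d1)].
Proof.
case: h => //= e /(_ e) n; have E (b : bool) : (e, b).1 \notin xs by apply/negP => /n; rewrite eqxx.
have [e1 e2 e3] := before_triangle_outer c (E true).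
have [f1 f2 f3] := before_triangle_outer c (E false).
by rewrite /cyclic !(beforeC _ _ (arrow_head e)) e1 e2 e3 f1 f2 f3.
Qed.

(** [option bool] is a concrete type with three elements, over which the closed word can be
    evaluated. *)
Let x (i : option bool) := if i is Some b then if b then x2 else x3 else x1.
Let V c := r3_word c None (Some true) (Some false) d1 d2 d3 [::] [::] [::].

Let x_inj : injective x.
Proof.
have := triangle_uniq; rewrite /= !inE negb_or.
move=> /and3P[/andP[/negbTE n12 /negbTE n13] /negbTE n23 _].
by move=> [[]|] [[]|] //= /eqP; rewrite ?n12 ?n13 ?n23 // eq_sym ?n12 ?n13 ?n23.
Qed.

Let mem_x i : x i \in xs.
Proof. by case: i => [[]|]; rewrite !inE eqxx ?orbT. Qed.

(** Relative to each other, the six points of the triangle are ordered as in the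
    closed word [V c], where weights can be computed.  The restriction that [c]
    puts on the strands enters only through these computations. *)
Lemma before_triangle_model c p q :
  before (W c) (relabel x p) (relabel x q) = before (V c) p q.
Proof.
rewrite -(before_map (V c) p q (relabel_inj x_inj)) before_triangle_inner ?mem_x //.
by congr before; rewrite /W0 /V /r3_word /r3_strand !cats0; do 3! case: ifP.
Qed.

Lemma weight_triangle_model c i j b :
  weight (W c) (Some (x i)) (x j, b) = weight (V c) (Some i) (j, b).
Proof. by rewrite /weight /cyclic -!before_triangle_model. Qed.

(** The tail and head of one crossing lie on different strands, so the move does not change their
    order; nor does it change the order of [z] and any letter. *)
Lemma weight_triangle_far g z : z.1 \notin xs ->
  weight (W true) g z = weight (W false) g z.
Proof.
move=> nz; case: g => //= e; rewrite /cyclic !(beforeC _ _ z) !(before_triangle_swap _ nz).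
case: (boolP (e \in xs)) => [ei|ne]; last by rewrite (@before_triangle_swap (arrow_head e)).
have [i ->] : exists i, e = x i.
  move: ei; rewrite !inE => /or3P[]/eqP->;
    by [exists None | exists (Some true) | exists (Some false)].
congr (_ + _ + _); rewrite (before_triangle_model _ (arrow_head i) (arrow_tail i)).
rewrite (before_triangle_model _ (arrow_head i) (arrow_tail i)) /V.
by case: i => [[]|]; case: d1; case: d2; case: d3; vm_compute.
Qed.

(** Minors at arrows outside the triangle do not change one by one; at the three crossings only
    their sum is compared. It is a numerical check if both rows belong to the triangle, and
    unchanged weights if neither does. *)
Lemma weight_form_triangle g h : weight_form (W true) g h = weight_form (W false) g h.
Proof.
pose sum_xs (F : A -> int) : int := F x1 + F x2 + F x3.
have split3 (F : A -> int) : \sum_z F z = sum_xs F + \sum_(z | z \notin xs) F z.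
  rewrite (bigID (mem xs)) /= -big_uniq ?triangle_uniq //.
  by rewrite /xs !big_cons big_nil /= addr0 !addrA.
rewrite /weight_form !split3; congr (_ + _); last first.
  by apply: eq_bigr => z nz; rewrite /minor !weight_triangle_far.
have in_out k : (exists i, k = Some (x i)) \/ (forall i, i \in xs -> k != Some i).
  case: k => [k|]; last by right.
  case: (boolP (k \in xs)) => [|nk].
    rewrite !inE => /or3P[]/eqP->; left;
      by [exists None | exists (Some true) | exists (Some false)].
  by right => i ixs; apply: contraNneq nk => -[->].
(* The outside row has a single value on each strand, so for each crossing and choice of signs an
   identity in three unknowns remains. *)
have mixed i k : (forall l, l \in xs -> k != Some l) ->
    sum_xs (minor (W true) (Some (x i)) k) = sum_xs (minor (W false) (Some (x i)) k).
  move=> ok; have [e1 e2 e3] := weight_triangle_outer true ok; move: e1 e2 e3.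
  rewrite /sum_xs /minor /arrow_tail /arrow_head -!(weight_triangle_swap _ ok).
  rewrite -[x1]/(x None) -[x2]/(x (Some true)) -[x3]/(x (Some false)).
  rewrite !weight_triangle_model /V; move: (weight (W true) k) => H.
  case: i => [[]|]; case: d1; case: d2; case: d3;
    (* Weights in the model word are closed and become numerals, while the outside row [H] stays
       symbolic. *)
    repeat (match goal with |- context [weight ?a (Some ?b) ?c] =>
      let t := constr:(weight a (Some b) c) in let n := eval vm_compute in t in
      change t with n end);
    move=> /= -> -> ->; ring.
have skew c k l : sum_xs (minor (W c) k l) = - sum_xs (minor (W c) l k).
  by rewrite /sum_xs /minor; ring.
have [[i ->]|og] := in_out g; have [[j ->]|oh] := in_out h.
- rewrite /sum_xs /minor -[x1]/(x None) -[x2]/(x (Some true)) -[x3]/(x (Some false)).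
  rewrite /arrow_tail /arrow_head !weight_triangle_model /V.
  by case: i => [[]|]; case: j => [[]|]; case: d1; case: d2; case: d3; vm_compute.
- exact: mixed.
- by have := mixed j g og; rewrite !(skew _ _ g) => /oppr_inj.
by rewrite /sum_xs /minor !(weight_triangle_swap _ og) !(weight_triangle_swap _ oh).
Qed.

End Triangle.

(** * Moves on virtual strings *)

Lemma weight_form_inj (alpha beta : virtual_string) (g h : option (arr alpha))
    (g' h' : option (arr beta)) :
  weight_form (pts alpha) g h = weight_form (pts beta) g' h' ->
  string_b g h = string_b g' h'.
Proof. by rewrite -!string_bE; apply: mulfI. Qed.

Section Relabelling.

Variables (alpha : virtual_string) (B : finType) (f : arr alpha -> B).
Hypothesis f_uniq : uniq (map (relabel f) (pts alpha)).

(** [pts alpha] lists every point once, so an image word without repetition makes [relabel f]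
    injective. *)
Lemma relabel_pts_inj : injective f.
Proof.
have E : perm_eq (pts alpha) (enum predT).
  by apply: uniq_perm; rewrite ?pts_uniq ?enum_uniq // => p; rewrite pts_full mem_enum.
have /injectiveP fI : injectiveb (relabel f).
  by rewrite /injectiveb /dinjectiveb -(perm_uniq (perm_map _ E)).
by move=> x y E'; have [] : (x, true) = (y, true) by apply: fI; rewrite /relabel /= E'.
Qed.

Lemma mem_relabel_pts z b : ((z, b) \in map (relabel f) (pts alpha)) = (z \in codom f).
Proof.
apply/mapP/codomP => [[[e c] _ [-> _]]|[e ->]]; first by exists e.
by exists (e, b); rewrite ?pts_full.
Qed.

End Relabelling.

Lemma weight_form_map (A B : finType) (f : A -> B) w g h : bijective f ->
  weight_form (map (relabel f) w) (omap f g) (omap f h) = weight_form w g h.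
Proof.
move=> fB; rewrite /weight_form (reindex f) /=; last exact: onW_bij.
apply: eq_bigr => x _; rewrite /minor.
rewrite (_ : arrow_tail (f x) = relabel f (arrow_tail x)) //.
rewrite (_ : arrow_head (f x) = relabel f (arrow_head x)) //.
by rewrite !weight_map //; apply: bij_inj.
Qed.

Lemma omap_bij (A B : Type) (f : A -> B) : bijective f -> bijective (omap f).
Proof. by case=> g fK gK; exists (omap g) => [[x|]|[x|]] //=; rewrite ?fK ?gK. Qed.

(** The permutation makes [f] bijective: [pts beta] has no repetition and contains every point. *)
Lemma string_isomorphic (alpha beta : virtual_string) (f : arr alpha -> arr beta) :
  perm_eq (map (relabel f) (pts alpha)) (pts beta) ->
  (forall g h, weight_form (pts beta) g h = weight_form (map (relabel f) (pts alpha)) g h) ->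
  bm_isomorphic (string_matrix alpha) (string_matrix beta).
Proof.
move=> E Eb; have fI : injective f.
  by apply: relabel_pts_inj; rewrite (perm_uniq E) pts_uniq.
have fB : bijective f.
  apply: inj_card_bij => //; rewrite -(card_codom fI); apply: subset_leq_card.
  by apply/subsetP => z _; rewrite -(mem_relabel_pts f z true) (perm_mem E) pts_full.
exists (omap f); first exact: omap_bij.
split=> // g h; apply: weight_form_inj.
by rewrite Eb; apply: weight_form_map.
Qed.

Lemma weight_form_rot (A : finType) k (w : seq (A * bool)) g h :
  uniq w -> (forall p, p \in w) -> weight_form (rot k w) g h = weight_form w g h.
Proof.
move=> U F; have E i p : weight (rot k w) i p = weight w i p.
  by case: i => //= e; rewrite cyclic_rot.
by apply: eq_bigr => x _; rewrite /minor !E.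
Qed.

Lemma string_rot_isomorphic (alpha beta : virtual_string) (f : arr alpha -> arr beta) k :
  pts beta = rot k (map (relabel f) (pts alpha)) ->
  bm_isomorphic (string_matrix alpha) (string_matrix beta).
Proof.
move=> E; have P : perm_eq (map (relabel f) (pts alpha)) (pts beta).
  by rewrite E perm_sym perm_rot.
apply: (string_isomorphic P) => g h; rewrite E; apply: weight_form_rot.
  by rewrite (perm_uniq P) pts_uniq.
by move=> p; rewrite (perm_mem P) pts_full.
Qed.

Lemma string_R3_isomorphic (alpha beta : virtual_string) (f : arr alpha -> arr beta)
    c x1 x2 x3 d1 d2 d3 u v w :
  map (relabel f) (pts alpha) = r3_word c x1 x2 x3 d1 d2 d3 u v w ->
  pts beta = r3_word (~~ c) x1 x2 x3 d1 d2 d3 u v w ->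
  bm_isomorphic (string_matrix alpha) (string_matrix beta).
Proof.
move=> E E'; apply: (@string_isomorphic _ _ f) => [|g h].
  by rewrite E E'; apply: r3_word_perm.
have U : uniq (r3_word true x1 x2 x3 d1 d2 d3 u v w).
  by rewrite -(perm_uniq (r3_word_perm (~~ c) _ _ _ _ _ _ _ _ _ _)) -E' pts_uniq.
by rewrite E E'; case: c {E E'}; rewrite (weight_form_triangle U).
Qed.

(** * Extensions by two arrows *)

Section Extension.

Variables (alpha beta : virtual_string) (f : arr alpha -> arr beta) (x y : arr beta).
Hypotheses (f_sub : subseq (map (relabel f) (pts alpha)) (pts beta)) (nxy : x != y).
Hypothesis new_arrows : forall z b,
  ((z, b) \in map (relabel f) (pts alpha)) = (z \notin [:: x; y]).

Let f_inj : injective f.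
Proof. by apply: relabel_pts_inj; apply: subseq_uniq f_sub (pts_uniq beta). Qed.

Lemma weight_extension g p :
  weight (pts beta) (omap f g) (relabel f p) = weight (pts alpha) g p.
Proof.
rewrite -(weight_map (pts alpha) g p f_inj); case: g => //= e; rewrite /cyclic.
have F b : (f e, b) \in map (relabel f) (pts alpha).
  by rewrite mem_relabel_pts codom_f.
have Fp : relabel f p \in map (relabel f) (pts alpha) by rewrite map_f ?pts_full.
by rewrite !(before_subseq f_sub (pts_uniq beta)) ?F.
Qed.

Lemma sum_extension (F : arr beta -> int) : \sum_z F z = F x + F y + \sum_e F (f e).
Proof.
rewrite (bigID (mem [:: x; y])) /= -big_uniq; last by rewrite /= inE nxy.
rewrite !big_cons big_nil /= addr0; congr (_ + _).
rewrite -(@big_image _ _ _ _ _ f predT F) big_uniq; last by rewrite map_inj_uniq ?enum_uniq.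
by apply: eq_bigl => z; rewrite -(mem_relabel_pts f z true) new_arrows.
Qed.

(** Between old elements, the two new arrows contribute minors that cancel, and the old arrows
    contribute as before since old letters keep their order. *)
Lemma string_two_extension :
  (forall g h, g != Some x -> g != Some y -> h != Some x -> h != Some y ->
    minor (pts beta) g h x + minor (pts beta) g h y = 0) ->
  @two_extension (string_matrix alpha) (string_matrix beta) (omap f) (Some x) (Some y).
Proof.
move=> E0; have nf e : f e \notin [:: x; y].
  by rewrite -(new_arrows _ true) mem_relabel_pts codom_f.
have n g : omap f g != Some x /\ omap f g != Some y.
  case: g => //= e; have := nf e; rewrite !inE negb_or => /andP[nx ny].
  by split; [apply: contra nx | apply: contra ny] => /eqP[->].
split=> //.
- by move=> [e|] [e'|] //= [/f_inj ->].
- move=> g h; apply: weight_form_inj; rewrite /weight_form sum_extension E0 ?add0r;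
    try by case: (n g) (n h) => ? ? [].
  by apply: eq_bigr => z _; rewrite /minor -!weight_extension.
- case=> [z|] /=.
    have -> : (Some z \in [:: Some x; Some y]) = (z \in [:: x; y]) by rewrite !inE.
    rewrite -(new_arrows z true) mem_relabel_pts; apply/codomP/codomP => -[].
      by case=> [e|] //= [->]; exists e.
    by move=> e ->; exists (Some e).
  by transitivity true; first by apply/codomP; exists None.
Qed.

End Extension.

Lemma string_b_annihilating (alpha : virtual_string) (x : arr alpha) :
  (forall h, weight_form (pts alpha) (Some x) h = 0) ->
  @annihilating (string_matrix alpha) (Some x).
Proof.
move=> E; split=> // h; have := string_bE (Some x) h.
by rewrite E => /eqP; rewrite mulf_eq0 => /orP[|/eqP].
Qed.

Lemma string_R1_extension (alpha beta : virtual_string) (f : arr alpha -> arr beta) p q :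
  pts beta = kink p ++ kink q ++ map (relabel f) (pts alpha) ->
  framed_extension (string_matrix alpha) (string_matrix beta).
Proof.
move=> E; have U := pts_uniq beta; rewrite E in U.
have Up : uniq ([::] ++ kink p ++ (kink q ++ map (relabel f) (pts alpha))) by [].
have Ep g h : g != Some p.1 -> h != Some p.1 -> minor (pts beta) g h p.1 = 0.
  by rewrite E; apply: (minor_kink Up).
have Eq g h : g != Some q.1 -> h != Some q.1 -> minor (pts beta) g h q.1 = 0.
  by rewrite E; apply: (minor_kink U).
have Fp h : weight_form (pts beta) (Some p.1) h = if p.2 then 0 else weight_form (pts beta) None h.
  by rewrite E; apply: (weight_form_kink Up).
have Fq h : weight_form (pts beta) (Some q.1) h = if q.2 then 0 else weight_form (pts beta) None h.
  by rewrite E; apply: (weight_form_kink U).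
move: (U); rewrite !cat_uniq => /and3P[_ /hasPn np /and3P[_ /hasPn nqf Uf]].
have nxy : p.1 != q.1.
  by have := np q; rewrite mem_cat inE eqxx /= mem_kink eq_sym; apply.
have new_points z b : ((z, b) \in map (relabel f) (pts alpha)) = (z \notin [:: p.1; q.1]).
  have := pts_full (z, b); rewrite E !mem_cat !mem_kink !inE /=.
  have := np (z, b); have := nqf (z, b); rewrite mem_cat orbC /= !mem_kink /=.
  by case: (_ \in _) => [/(_ isT)/negbTE-> /(_ isT)/negbTE->|_ _] //; rewrite orbF => ->.
have ext : @two_extension (string_matrix alpha) (string_matrix beta) (omap f) (Some p.1) (Some q.1).
  apply: string_two_extension => // [|g h gp gq hp hq]; last by rewrite Ep ?Eq ?addr0.
  by rewrite E catA; apply: suffix_subseq.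
have cp : if p.2 then @annihilating (string_matrix beta) (Some p.1)
          else @core (string_matrix beta) (Some p.1).
  case: ifP => p2; first by apply: string_b_annihilating => h; rewrite Fp p2.
  by split=> // h; apply: weight_form_inj; rewrite Fp p2.
have cq : if q.2 then @annihilating (string_matrix beta) (Some q.1)
          else @core (string_matrix beta) (Some q.1).
  case: ifP => q2; first by apply: string_b_annihilating => h; rewrite Fq q2.
  by split=> // h; apply: weight_form_inj; rewrite Fq q2.
(* Kinks of equal type extend by two annihilating or two core elements; for opposite types the rows
   are 0 and that of [s], hence complementary. *)
move: cp cq; case: p.2; case: q.2 => cp cq.
- exact: ext_M1 ext cp cq.
- apply: ext_M3 ext _; case: cp cq => n1 a1 [n2 a2]; split=> // h.
  by rewrite a1 a2 add0r.
- apply: ext_M3 ext _; case: cp cq => n1 a1 [n2 a2]; split=> // h.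
  by rewrite a1 a2 addr0.
exact: ext_M2 ext cp cq.
Qed.

Lemma string_R2_extension (alpha beta : virtual_string) (f : arr alpha -> arr beta)
    x y t (same : bool) u v :
  map (relabel f) (pts alpha) = u ++ v ->
  pts beta = [:: (x, t); (y, ~~ t)] ++ u ++
    (if same then [:: (x, ~~ t); (y, t)] else [:: (y, t); (x, ~~ t)]) ++ v ->
  framed_extension (string_matrix alpha) (string_matrix beta).
Proof.
move=> Eu E; have U := pts_uniq beta; rewrite E in U.
have nxy := bigon_neq U.
have ext : @two_extension (string_matrix alpha) (string_matrix beta) (omap f) (Some x) (Some y).
  apply: string_two_extension => // [|z b|g h gx gy hx hy].
  - rewrite Eu E; apply: subseq_trans (suffix_subseq [:: _; _] _).
    by apply: cat_subseq => //; apply: suffix_subseq.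
  - rewrite Eu; apply/idP/idP => [zuv|nz].
      (* An old letter at [x] or [y] would repeat one of the four letters of the bigon. *)
      apply/negP => zi; move: zuv; rewrite mem_cat.
      have := mem_bigon x y t same (z, b); rewrite /= zi => /esym.
      move: (U); rewrite !cat_uniq !has_cat !negb_or.
      move=> /and3P[_ /andP[/hasPn h1 /andP[_ /hasPn h3]]].
      move=> /and3P[_ /andP[/hasPn h4 _] /and3P[_ /hasPn h6 _]].
      by case/orP => qi; apply/negP; rewrite negb_or; apply/andP; split; apply/negP => qj;
        [move: (h1 _ qj)|move: (h3 _ qj)|move: (h4 _ qi)|move: (h6 _ qj)]; rewrite /= ?qi ?qj.
    have := pts_full (z, b); rewrite E !mem_cat; move: nz.
    rewrite -[z]/(z, b).1 (mem_bigon x y t same) negb_or.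
    by case/andP => /negbTE -> /negbTE ->.
  by rewrite E; apply: (minor_bigon U).
apply: ext_M3 ext _; split=> // h.
apply: (@mulfI _ 4) => //; rewrite mulrDr.
rewrite (string_bE (Some x) h) (string_bE (Some y) h) (string_bE None h) E.
exact: (weight_form_bigon U).
Qed.

(** * Flat part of a diagram *)

Section FlatString.

Variable D : flat_diagram.

Definition flat_arrow : finType := {e : arr D | ~~ virt e}.

(** Being [None] at virtual crossings, it deletes their points from a word while retyping the others
    in the subtype of flat crossings. *)
Definition flat_point (p : arr D * bool) : option (flat_arrow * bool) :=
  omap (pair^~ p.2) (insub p.1).

Definition flat_word : seq (arr D * bool) -> seq (flat_arrow * bool) := pmap flat_point.

Lemma flat_pointK : ocancel flat_point (relabel val).
Proof. by case=> e b; rewrite /flat_point; case: insubP => //= e' _ <-. Qed.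

Lemma flat_point_val p : flat_point (relabel val p) = Some p.
Proof. by case: p => e b; rewrite /flat_point /= valK. Qed.

Lemma flat_point_virt p : virt p.1 -> flat_point p = None.
Proof. by move=> vp; rewrite /flat_point insubN //= vp. Qed.

Lemma flat_word_uniq : uniq (flat_word (pts D)).
Proof. by apply: (pmap_uniq flat_pointK); apply: pts_uniq. Qed.

Lemma flat_word_full p : p \in flat_word (pts D).
Proof.
have := map_f flat_point (pts_full (relabel val p : arr D * bool)).
by rewrite flat_point_val -mem_pmap.
Qed.

Definition flat_string := VirtualString flat_word_uniq flat_word_full.

Lemma flat_wordK s : map (relabel val) (flat_word s) = [seq p <- s | ~~ virt p.1].
Proof.
rewrite (pmap_filter flat_pointK); apply: eq_filter => p /=.
by rewrite /flat_point; case: insubP => [u -> //|/negbTE->].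
Qed.

Lemma flat_word_cat s1 s2 : flat_word (s1 ++ s2) = flat_word s1 ++ flat_word s2.
Proof. exact: pmap_cat. Qed.

Lemma flat_word_cons p s : flat_word (p :: s) = seq_of_opt (flat_point p) ++ flat_word s.
Proof. by rewrite /flat_word /=; case: flat_point. Qed.

Lemma flat_word_rot k s : exists k', flat_word (rot k s) = rot k' (flat_word s).
Proof.
(* The new shift counts the flat points among those rotated away. *)
exists (size (flat_word (take k s))); rewrite [LHS]flat_word_cat.
by rewrite -[X in rot _ (flat_word X)](cat_take_drop k s) flat_word_cat rot_size_cat.
Qed.

Lemma flat_pointP (p : arr D * bool) :
  ~~ virt p.1 -> exists p' : flat_arrow * bool, p = relabel val p'.
Proof. by case: p => e b /= ve; exists (exist _ e ve, b). Qed.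

End FlatString.

(** At most one letter of such a strand survives, so its order is invisible. *)
Lemma flat_word_r3_strand (D : flat_diagram) c d (p q : arr D * bool) :
  virt p.1 || virt q.1 ->
  flat_word (r3_strand c d p q) = flat_word (r3_strand (~~ c) d p q).
Proof.
rewrite /r3_strand; case/orP => /flat_point_virt E;
  by case: ifP; case: ifP => // _ _; rewrite !flat_word_cons E /= ?cats0.
Qed.

(** An encoding differs from the flat string only by names of arrows and base point. *)
Lemma encodes_isomorphic (alpha : virtual_string) (D : flat_diagram) :
  encodes alpha D -> bm_isomorphic (string_matrix alpha) (string_matrix (flat_string D)).
Proof.
case=> f [k E]; have vf e : ~~ virt (f e).
  have : relabel f (e, true) \in map (relabel f) (pts alpha) by rewrite map_f ?pts_full.
  by rewrite E mem_rot mem_filter => /andP[].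
pose g e : flat_arrow D := exist _ (f e) (vf e).
have {}E : map (relabel g) (pts alpha) = rot k (pts (flat_string D)).
  apply: (inj_map (relabel_inj val_inj)).
  by rewrite map_rot flat_wordK -E -map_comp; apply: eq_map => -[].
(* The complementary shift undoes the rotation by [k]. *)
apply: (@string_rot_isomorphic alpha (flat_string D) g (size (pts (flat_string D)) - k)).
by rewrite -{1}(rotK k (pts (flat_string D))) /rotr size_rot E.
Qed.

(** * Flat parts along a move *)

Section FlatMap.

Variables (D E : flat_diagram) (f : arr D -> arr E).
Hypothesis f_virt : forall e, virt (f e) = virt e.

Lemma flat_map_subproof (e : flat_arrow D) : ~~ virt (f (val e)).
Proof. by rewrite f_virt (valP e). Qed.

Definition flat_map (e : flat_arrow D) : flat_arrow E :=
  exist _ (f (val e)) (flat_map_subproof e).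

Lemma flat_word_map s :
  flat_word (map (relabel f) s) = map (relabel flat_map) (flat_word s).
Proof.
apply: (inj_map (relabel_inj val_inj)); rewrite flat_wordK filter_map -map_comp.
rewrite (eq_map (_ : _ =1 relabel f \o relabel val)) // map_comp flat_wordK.
by congr map; apply: eq_filter => p /=; rewrite f_virt.
Qed.

End FlatMap.

(** On flat parts, each move either becomes the same move with flat crossings only, or disappears up
    to relabelling and base point. *)
Lemma framed_move_homologous (D E : flat_diagram) : framed_move D E ->
  bm_isomorphic (string_matrix (flat_string D)) (string_matrix (flat_string E)) \/
  framed_extension (string_matrix (flat_string D)) (string_matrix (flat_string E)).
Proof.
have iso f k (fv : forall e, virt (f e) = virt e) :
    pts (flat_string E) = rot k (flat_word (map (relabel f) (pts D))) ->
    bm_isomorphic (string_matrix (flat_string D)) (string_matrix (flat_string E)).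
  by rewrite (flat_word_map fv); apply: (@string_rot_isomorphic (flat_string D)).
case.
- move=> f k fv /(congr1 (@flat_word E)).
  have [k' ->] := flat_word_rot k (map (relabel f) (pts D)).
  by move=> /(iso f k' fv); left.
- move=> f p fv vp /(congr1 (@flat_word E)).
  rewrite flat_word_cat /kink !flat_word_cons !flat_point_virt //= => EE.
  by left; apply: (iso f 0 fv); rewrite rot0.
- move=> f p q fv /flat_pointP[p' ->] /flat_pointP[q' ->] /(congr1 (@flat_word E)).
  rewrite !flat_word_cat (flat_word_map fv) => H.
  have K p0 : flat_word (kink (relabel val p0)) = kink p0 :> seq (flat_arrow E * bool).
    rewrite /kink !flat_word_cons flat_point_val.
    by rewrite (flat_point_val (opposite p0)).
  rewrite !K in H; right.
  exact: (@string_R1_extension (flat_string D) (flat_string E) (flat_map fv) p' q' H).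
- move=> f x y t same u v fv vxy /(congr1 (@flat_word E)) Eu /(congr1 (@flat_word E)).
  rewrite !flat_word_cat (flat_word_map fv) in Eu *.
  have [vx|nx] := boolP (virt x).
    have vy : virt y by rewrite -vxy.
    have -> : flat_word (if same then [:: (x, ~~ t); (y, t)] else [:: (y, t); (x, ~~ t)]) = [::].
      by case: same; rewrite !flat_word_cons !flat_point_virt.
    rewrite !flat_word_cons !flat_point_virt //= -Eu -(flat_word_map fv) => EE.
    by left; apply: (iso f 0 fv); rewrite rot0.
  have ny : ~~ virt y by rewrite -vxy.
  pose x' : flat_arrow E := exist _ x nx; pose y' : flat_arrow E := exist _ y ny.
  have -> : flat_word (if same then [:: (x, ~~ t); (y, t)] else [:: (y, t); (x, ~~ t)]) =
      if same then [:: (x', ~~ t); (y', t)] else [:: (y', t); (x', ~~ t)].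
    by case: same; rewrite !flat_word_cons (flat_point_val (x', ~~ t)) (flat_point_val (y', t)).
  rewrite !flat_word_cons (flat_point_val (x', t)) (flat_point_val (y', ~~ t)) => EE.
  by right; apply: (@string_R2_extension (flat_string D) (flat_string E) _ _ _ _ _ _ _ Eu EE).
move=> f c x1 x2 x3 d1 d2 d3 u v w fv nv /(congr1 (@flat_word E)) Eu /(congr1 (@flat_word E)) EE.
left; have [/and3P[n1 n2 n3]|] := boolP [&& ~~ virt x1, ~~ virt x2 & ~~ virt x3].
  pose y1 : flat_arrow E := exist _ x1 n1; pose y2 : flat_arrow E := exist _ x2 n2.
  pose y3 : flat_arrow E := exist _ x3 n3.
  have R c' : flat_word (r3_word c' x1 x2 x3 d1 d2 d3 u v w) =
      r3_word c' y1 y2 y3 d1 d2 d3 (flat_word u) (flat_word v) (flat_word w).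
    have S d p q : flat_word (r3_strand c' d (relabel val p) (relabel val q)) =
        r3_strand c' d p q :> seq (flat_arrow E * bool).
      by rewrite /r3_strand; case: ifP; rewrite !flat_word_cons !flat_point_val.
    by rewrite /r3_word !flat_word_cat -!S.
  rewrite R (flat_word_map fv) in Eu; rewrite R in EE.
  exact: (@string_R3_isomorphic (flat_string D) (flat_string E) _ _ _ _ _ _ _ _ _ _ _ Eu EE).
(* At least two of the three crossings are virtual, so every strand carries a virtual one. *)
move=> nflat; apply: (iso f 0 fv); rewrite rot0 Eu [LHS]EE /r3_word !flat_word_cat.
rewrite (flat_word_r3_strand c d1) 1?(flat_word_r3_strand c d2) 1?(flat_word_r3_strand c d3) //=.
all: by move: nv nflat; case: (virt x1); case: (virt x2); case: (virt x3).
Qed.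

Theorem theorem23 (alpha beta : virtual_string) :
  framed_homotopic alpha beta ->
  homologous (string_matrix alpha) (string_matrix beta).
Proof.
case=> D [E [/encodes_isomorphic aD /encodes_isomorphic bE DE]].
(* Both strings are replaced by the flat strings of their diagrams, and the chain of moves is
   followed there. *)
apply: (@rst_trans _ _ _ (string_matrix (flat_string D))); first by apply: rst_step; left.
apply: (@rst_trans _ _ _ (string_matrix (flat_string E))); last first.
  by apply: rst_sym; apply: rst_step; left.
elim: DE => {D E aD bE}.
- by move=> D E /framed_move_homologous; apply: rst_step.
- by move=> D; apply: rst_refl.
- by move=> D E _; apply: rst_sym.
by move=> D E F _ DE _; apply: rst_trans.
Qed.
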